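(* Let $s\in\{+1,-1\}$ and $d\ge1$. Let $f\in L^1(\mathbb T^d)$ be real-valued and nonzero, with real-valued Fourier coefficients $\widehat f$ (e.g. $f$ even) and $\widehat f\in\ell^1(\mathbb Z^d)$, such that $\int_{\mathbb T^d}f\,d\lambda\le0$ and $\sum_{m\in\mathbb Z^d}s\widehat f(m)\le0$. Then $$\lambda(\{x\in\mathbb T^d: f(x)<0\})\cdot\#\{m\in\mathbb Z^d: s\widehat f(m)<0\}\ \ge\ \frac1{16}.$$
   Context: $\mathbb T^d=\mathbb R^d/\mathbb Z^d$, identified with $[-\tfrac12,\tfrac12]^d$, with Haar probability measure $\lambda$ (Lebesgue measure on $[-\tfrac12,\tfrac12]^d$). $\widehat f(m)=\int_{\mathbb T^d}f(x)e^{-2\pi i\langle x,m\rangle}d\lambda(x)$ for $m\in\mathbb Z^d$. *)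

(* Defs.v *)
From HB Require Import structures.
From mathcomp Require Import all_boot all_order all_algebra.
From mathcomp Require Import all_classical all_reals all_analysis.
Set Implicit Arguments. Unset Strict Implicit. Unset Printing Implicit Defensive.
Import Order.TTheory GRing.Theory Num.Theory.
Import numFieldNormedType.Exports.
Local Open Scope classical_set_scope.
Local Open Scope ring_scope.

(* The torus T^d is identified with the cube [-1/2,1/2]^d inside d.-tuple R
   (with the product sigma-algebra of Borel sets); its Haar probability
   measure is the d-fold product of the uniform probability on [-1/2,1/2]. *)

Section torus.
Variable R : realType.

Lemma half_lt : (- (1/2) : R) < 1/2.
Proof. by rewrite gtrN // divr_gt0. Qed.

Definition unifT : probability (measurableTypeR R) R := uniform_prob half_lt.

Definition torus (n : nat) := n.-tuple (measurableTypeR R).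

Definition tcons n (p : measurableTypeR R * torus n) : torus n.+1 := [tuple of p.1 :: p.2].

Lemma measurable_tcons n : measurable_fun setT (@tcons n).
Proof. exact: (measurable_cons measurable_fst measurable_snd). Qed.

HB.instance Definition _ n := isMeasurableFun.Build _ _ _ _ (@tcons n)
  (@measurable_tcons n).

Fixpoint torus_prob (n : nat) : probability (torus n) R :=
  match n with
  | 0%N => @dirac _ (torus 0) [tuple] R
  | n'.+1 => distribution (unifT \x torus_prob n')%E (@tcons n')
  end.

Definition dotZ d (x : torus d) (m : d.-tuple int) : R :=
  \sum_(i < d) tnth x i * (tnth m i)%:~R.

(* real and imaginary parts of  \hat f(m) = \int f(x) e^{-2 pi i <x,m>} dx *)
Definition fourier_re d (f : torus d -> R) (m : d.-tuple int) : R :=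
  Rintegral (torus_prob d) setT (fun x => f x * cos (2 * pi * dotZ x m)).
Definition fourier_im d (f : torus d -> R) (m : d.-tuple int) : R :=
  - Rintegral (torus_prob d) setT (fun x => f x * sin (2 * pi * dotZ x m)).

(* sum over Z^d of an absolutely summable real family:
   sum of positive parts minus sum of negative parts *)
Definition zsum d (a : d.-tuple int -> R) : \bar R :=
  (\esum_(m in setT) (Num.max (a m) 0)%:E - \esum_(m in setT) (Num.max (- a m) 0)%:E)%E.

End torus.

(* Main.v *)
Require Import Defs.
From HB Require Import structures.
From mathcomp Require Import all_boot all_order all_algebra.
From mathcomp Require Import all_classical all_reals all_analysis.
From mathcomp Require Import measurable_realfun ring lra.
Import Order.TTheory GRing.Theory Num.Theory.
Import numFieldNormedType.Exports.
Local Open Scope classical_set_scope.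
Local Open Scope ring_scope.

(* Let r be the L^1 norm of f, A the l^1 norm of its Fourier coefficients, l the
   measure of {f < 0} and K the number of m with s f^(m) < 0.  As f has
   nonpositive mean, r is at most twice the integral of its negative part, which
   is at most A l because |f| <= A almost everywhere; dually A <= 2 r K because
   |f^(m)| <= r.  Hence r <= 4 r l K, even with 1/4 in place of 1/16.

   The bound |f| <= A a.e. needs Fourier inversion.  Let S be the sum of the
   absolutely convergent series of the f^(m) cos(2 pi <x, m>).  Then h = f - S is
   orthogonal to all trigonometric polynomials.  For a trigonometric polynomial p
   an affine image u of p maps {p > 0} to {u < 1/2}, 0 <= u <= 1, and
   (1 - u^n)^(n 2^n) tends to the indicator of {u < 1/2}, so h integrates to 0 over
   finite intersections of such sets and of their complements.  Using cos(2 pi x_i)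
   and sin(2 pi x_i) these contain, up to null sets, all half-spaces {x_i > a},
   and the pi-lambda theorem yields h = 0 a.e. *)

(** * Powers approximating a step function at 1/2 *)

Section steep.
Context {R : realType}.
Implicit Types (x y z u : R) (n k : nat).

Lemma bernoulli_ge x n : -1 <= x -> 1 + n%:R * x <= (1 + x) ^+ n.
Proof.
move=> x1; elim: n => [|n IH]; first by rewrite mul0r addr0 expr0.
rewrite exprS; apply: le_trans (_ : (1 + x) * (1 + n%:R * x) <= _).
  rewrite -natr1.
  have h : 0 <= n%:R * x ^+ 2 by rewrite mulr_ge0 ?sqr_ge0.
  have -> : (1 + x) * (1 + n%:R * x) = 1 + (n%:R + 1) * x + n%:R * x ^+ 2 by ring.
  by rewrite lerDl.
by apply: ler_wpM2l => //; rewrite -lerBlDl sub0r.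
Qed.

(** With [y] the square root of [z], Bernoulli's inequality for [y^-1 = 1 + e] bounds [n y^n] by
    [e^-1]; the other factor [y^n] of [z^n] tends to 0. *)
Lemma cvg_natr_expr z : 0 <= z < 1 -> (n%:R * z ^+ n) @[n --> \oo] --> (0 : R).
Proof.
move=> /andP[z0 z1]; have [->|zn0] := eqVneq z 0.
  apply: cvg_near_cst; exists 1%N => // n /= n1.
  by rewrite expr0n eqn0Ngt n1 mulr0.
pose y := Num.sqrt z.
have yy : y ^+ 2 = z by rewrite sqr_sqrtr.
have y0 : 0 < y by rewrite sqrtr_gt0 lt0r zn0.
have y1 : y < 1.
  rewrite -(@ltr_pXn2r _ 2)// ?nnegrE ?(ltW y0)//.
  by rewrite yy expr1n.
pose e := y^-1 - 1.
have e0 : 0 < e by rewrite subr_gt0 invf_gt1.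
have ny n : n%:R * y ^+ n <= e^-1.
  have h : n%:R * e <= (y ^+ n)^-1.
    have e1 : -1 <= e by rewrite (le_trans _ (ltW e0)).
    by rewrite -exprVn -[y^-1](subrKC 1) (le_trans _ (bernoulli_ge e n e1))// lerDr.
  by rewrite -ler_pdivlMr ?exprn_gt0// mulrC ler_pdivlMr.
apply: (@squeeze_cvgr _ _ _ _ (fun=> 0) (fun n => e^-1 * y ^+ n)).
- apply: nearW => n; rewrite mulr_ge0 ?exprn_ge0//=.
  by rewrite -yy -exprM mulnC exprM expr2 mulrA ler_wpM2r// exprn_ge0// ltW.
- exact: cvg_cst.
- by rewrite -[X in _ --> X](mulr0 e^-1); apply: cvgMr; apply: cvg_expr;
    rewrite gtr0_norm.
Qed.

(* The exponent n 2^n, rather than 2^n, makes the limit vanish at u = 1/2 too. *)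
Lemma cvg_steep u : 0 <= u <= 1 ->
  (fun n => (1 - u ^+ n) ^+ (n * 2 ^ n)%N : R) @ \oo --> ((u < 1 / 2)%R%:R : R).
Proof.
move=> /andP[u0 u1].
have un0 n : 0 <= u ^+ n by rewrite exprn_ge0.
have un1 n : u ^+ n <= 1 by rewrite exprn_ile1.
case: ltP => [uh|uh].
  (* Bernoulli's inequality at [- u^n] with exponent [n 2^n] gives the lower bound, which tends to 1
     because [2u < 1]. *)
  apply: (@squeeze_cvgr _ _ _ _ (fun n => 1 - n%:R * (2 * u) ^+ n) (fun=> 1)).
  - apply: nearW => n; apply/andP; split; last first.
      by rewrite exprn_ile1 ?subr_ge0 ?gerBl.
    rewrite (le_trans _ (@bernoulli_ge _ _ _)) ?lerN2//.
    by rewrite natrM natrX exprMn mulrN mulrA.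
  - rewrite -[X in _ --> X]subr0; apply: cvgB; first exact: cvg_cst.
    by apply: cvg_natr_expr; lra.
  - exact: cvg_cst.
(* With [N = n 2^n], [(1 - u^n)^N (1 + u^n)^N = (1 - u^(2n))^N <= 1], while Bernoulli gives
   [(1 + u^n)^N >= 1 + n (2u)^n >= n + 1]. *)
apply: (@squeeze_cvgr _ _ _ _ (fun=> 0) (fun n => n.+1%:R^-1)).
- apply: nearW => n; rewrite exprn_ge0 ?subr_ge0//=.
  rewrite -[_^-1]mul1r ler_pdivlMr//.
  have h : (n.+1%:R : R) <= (1 + u ^+ n) ^+ (n * 2 ^ n)%N.
    rewrite (le_trans _ (@bernoulli_ge _ _ _))//; last first.
      by rewrite (le_trans _ (un0 _)).
    rewrite -natr1 addrC lerD2l natrM natrX -mulrA -exprMn.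
    rewrite -[leLHS]mulr1 ler_wpM2l// exprn_ege1//; lra.
  rewrite (le_trans (ler_wpM2l _ h)) ?exprn_ge0 ?subr_ge0//.
  rewrite -exprMn exprn_ile1//.
    by rewrite mulr_ge0 ?subr_ge0 ?un1 ?addr_ge0 ?ler01 ?un0.
  by rewrite -subr_sqr expr1n gerBl exprn_ge0.
- exact: cvg_cst.
- exact: cvg_harmonic.
Qed.

End steep.

(** * Algebras of functions and almost everywhere vanishing *)

Section function_algebra.
Context {d} {T : measurableType d} {R : realType} (P : probability T R).
Implicit Types (V : set (T -> R)) (f g h : T -> R) (A B : set T).

Definition bounded_algebra V :=
  [/\ V (cst 1),
      forall a f, V f -> V (fun x => a * f x),
      forall f g, V f -> V g -> V (fun x => f x + g x),
      forall f g, V f -> V g -> V (fun x => f x * g x) &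
      forall f, V f -> measurable_fun setT f /\ exists M, forall x, `|f x| <= M].

(** The bounds 0 and 1 persist under products and complements and supply the domination for passing
    to the limit; convergence almost everywhere lets sets be changed on null sets. *)
Definition indic_limit V A := measurable A /\
  exists g : nat -> T -> R, [/\ forall n, V (g n),
    forall n x, 0 <= g n x <= 1 &
    {ae P, forall x, g n x @[n --> \oo] --> (\1_A x : R)}].

Lemma bounded_algebraB1 V f : bounded_algebra V -> V f -> V (fun x => 1 - f x).
Proof.
case=> V1 VZ VD VM _ Vf.
have -> : (fun x => 1 - f x) = (fun x => cst 1 x + -1 * f x).
  by apply/funext => x; rewrite mulN1r.
exact/VD/VZ.
Qed.

Lemma bounded_algebraX V f n : bounded_algebra V -> V f ->
  V (fun x => f x ^+ n).
Proof.
move=> [V1 VZ VD VM _] Vf; elim: n => [|n IH]; first exact: V1.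
have -> : (fun x => f x ^+ n.+1) = (fun x => f x * f x ^+ n).
  by apply/funext => x; rewrite exprS.
exact: VM.
Qed.

Lemma indic_limitC V A : bounded_algebra V ->
  indic_limit V A -> indic_limit V (~` A).
Proof.
move=> bV [mA [g [Vg g01 gA]]]; split; first exact: measurableC.
exists (fun n x => 1 - g n x); split.
- by move=> n; exact: bounded_algebraB1.
- by move=> n x; have := g01 n x => /andP[? ?]; apply/andP; split; lra.
- apply: filterS gA => x gx.
  have -> : \1_(~` A) x = 1 - \1_A x :> R by rewrite !indicE in_setC; case: (x \in A); rewrite ?subrr ?subr0.
  by apply: cvgB => //; exact: cvg_cst.
Qed.

Lemma indic_limitI V A B : bounded_algebra V ->
  indic_limit V A -> indic_limit V B -> indic_limit V (A `&` B).
Proof.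
move=> bV [mA [f [Vf f01 fA]]] [mB [g [Vg g01 gB]]].
split; first exact: measurableI.
exists (fun n x => f n x * g n x); split.
- by move=> n; case: bV => _ _ _ VM _; exact: VM.
- move=> n x; have /andP[? ?] := f01 n x; have /andP[? ?] := g01 n x.
  by rewrite mulr_ge0// mulr_ile1.
- apply: filterS2 fA gB => x fx gx.
  have -> : \1_(A `&` B) x = \1_A x * \1_B x :> R by rewrite indicI.
  exact: cvgM.
Qed.

Lemma indic_limit_ae V A B : measurable B -> {ae P, forall x, A x <-> B x} ->
  indic_limit V A -> indic_limit V B.
Proof.
move=> mB AB [mA [f [Vf f01 fA]]]; split => //; exists f; split => //.
apply: filterS2 AB fA => x ABx.
have -> // : \1_A x = \1_B x :> R.
by rewrite !indicE; congr (_%:R); congr nat_of_bool; apply/idP/idP; rewrite !inE => /ABx.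
Qed.

Lemma indic_limitT V : bounded_algebra V -> indic_limit V setT.
Proof.
move=> bV; split => //; exists (fun _ => cst 1); split.
- by case: bV.
- by move=> n x /=; rewrite ler01 lexx.
- by apply: nearW => x; rewrite indicT; exact: cvg_cst.
Qed.

(** The affine image [u = 1/2 - f / (2M)] has values in [0, 1] and is below 1/2 exactly where
    [f > 0], so [cvg_steep] applies. *)
Lemma indic_limit_gt0 V f : bounded_algebra V -> V f ->
  indic_limit V [set x | 0 < f x].
Proof.
move=> bV Vf; have [V1 VZ VD VM Vb] := bV; have [mf [M0 fM0]] := Vb _ Vf.
(* The maximum with 1 keeps the divisor [2 * M] positive even if the given bound is 0. *)
pose M := Num.max M0 1.
have M_gt0 : 0 < M by rewrite lt_max ltr01 orbT.
have fM x : `|f x| <= M by rewrite le_max fM0.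
pose u x : R := 1 / 2 - f x / (2 * M).
have fMh x : `|f x / (2 * M)| <= 1 / 2.
  rewrite normrM normfV (@ger0_norm _ (2 * M)); last by rewrite mulr_ge0// ltW.
  rewrite ler_pdivrMr ?mulr_gt0//.
  by rewrite div1r mulrA mulVf// mul1r.
have u01 x : 0 <= u x <= 1.
  by have := fMh x; rewrite ler_norml /u => /andP[? ?]; apply/andP; split; lra.
have Vu : V u.
  have -> : u = fun x => (1 / 2) * cst 1 x + (- (2 * M)^-1) * f x.
    by apply/funext => x; rewrite /u /=; ring.
  by apply: VD; exact: VZ.
split.
  rewrite -[X in measurable X]setTI.
  rewrite (_ : _ `&` _ = [set: T] `&` f @^-1` `]0, +oo[%classic).
    by apply: mf => //; exact: measurable_itv.
  by apply/seteqP; split => x /=; rewrite in_itv/= andbT.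
exists (fun n x => (1 - u x ^+ n) ^+ (n * 2 ^ n)%N); split.
- by move=> n; apply: bounded_algebraX => //; apply: bounded_algebraB1 => //;
    exact: bounded_algebraX.
- move=> n x; have /andP[u0 u1] := u01 x.
  by rewrite exprn_ge0 ?exprn_ile1 ?subr_ge0 ?exprn_ile1 ?gerBl ?exprn_ge0.
- apply: nearW => x.
  have -> : \1_[set x | 0 < f x] x = (u x < 1 / 2)%R%:R :> R.
    rewrite indicE; congr (nat_of_bool _)%:R; rewrite /u gtrBl.
    rewrite pmulr_lgt0 ?invr_gt0 ?mulr_gt0//.
    by apply/idP/idP; rewrite inE.
  exact: cvg_steep.
Qed.

(** Dominated convergence with majorant [|h|], as the approximants lie between 0 and 1. *)
Lemma indic_limit_integral0 V h A : bounded_algebra V ->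
  P.-integrable setT (EFin \o h) ->
  (forall g, V g -> Rintegral P setT (fun x => h x * g x) = 0) ->
  indic_limit V A -> (\int[P]_(x in A) (h x)%:E = 0)%E.
Proof.
move=> [_ _ _ _ Vb] ih hV [mA [g [Vg g01 gA]]].
have mh : measurable_fun setT h by apply/measurable_EFinP; exact: measurable_int ih.
have mg n : measurable_fun setT (g n) by have [] := Vb _ (Vg n).
have bg n : [bounded g n x | x in [set: T]].
  exists 1; split => // M M1 x _ /=; have /andP[? ?] := g01 n x.
  by rewrite ger0_norm// (le_trans _ (ltW M1)).
have hg0 n : (\int[P]_x (h x * g n x)%:E = 0)%E.
  (* [Rintegral] applies [fine], which also sends infinite values to 0; integrability turns its
     vanishing into that of the extended integral. *)
  have := hV _ (Vg n); rewrite /Rintegral => /eqP.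
  rewrite -eqe fineK => [/eqP //|].
  apply: integrable_fin_num => //.
  exact: (integrableMl measurableT ih (mg n) (bg n)).
rewrite integral_mkcond/=.
have [|||||_ _ +] := @dominated_convergence _ _ _ P setT measurableT
   (fun n x => (h x * g n x)%:E) ((fun x => (h x)%:E) \_ A) (fun x => (`|h x|)%:E).
- by move=> n; apply/measurable_EFinP; exact: measurable_funM.
- apply/(measurable_restrictT _ _).1 => //; exact/measurable_funTS/measurable_EFinP.
- apply: filterS gA => x gx _.
  have -> : ((fun x => (h x)%:E) \_ A) x = (h x * \1_A x)%:E.
    by rewrite patchE indicE; case: ifPn => _; rewrite ?mulr1 ?mulr0.
  by apply: cvg_EFin; [exact: nearW|apply: cvgM => //; exact: cvg_cst].
- exact: integrable_norm.
- apply: nearW => x n _ /=; rewrite lee_fin normrM.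
  have /andP[g0 g1] := g01 n x; rewrite (ger0_norm g0).
  by rewrite -[leRHS]mulr1 ler_wpM2l.
- under [X in X @ _ --> _ -> _]eq_fun do rewrite hg0.
  by move=> /cvg_unique; apply => //; exact: cvg_cst.
Qed.

(* The sets over which h integrates to 0 form a lambda-system; the sets
   approximable by V form a pi-system contained in it. *)
Lemma indic_limit_ae0 V h (G : set (set T)) : bounded_algebra V ->
  P.-integrable setT (EFin \o h) ->
  (forall g, V g -> Rintegral P setT (fun x => h x * g x) = 0) ->
  measurable `<=` <<s G >> -> G `<=` indic_limit V ->
  {ae P, forall x, h x = 0}.
Proof.
move=> bV ih hV mG GV.
have mh : measurable_fun setT h by apply/measurable_EFinP; exact: measurable_int ih.
have ihA A : measurable A -> P.-integrable A (EFin \o h).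
  by move=> mA; exact: integrableS ih.
pose H := [set A | measurable A /\ (\int[P]_(x in A) (h x)%:E = 0)%E].
have HD A B : B `<=` A -> H A -> H B -> H (A `\` B).
  move=> BA [mA A0] [mB B0]; split; first exact: measurableD.
  have := @integral_setU_EFin _ _ _ P (A `\` B) B h.
  rewrite setUC setDUK// A0 B0 adde0 => <- //.
  - exact: measurableD.
  - exact: measurable_funTS.
  - by apply/disj_setPS; rewrite setIC setDIK.
have subH : <<s indic_limit V >> `<=` H.
  apply: lambda_system_subset => //.
  - by move=> A B; exact: indic_limitI.
  - split.
    + by [].
    + split => //; apply: indic_limit_integral0 hV _ => //.
      exact: indic_limitT.
    + exact: HD.
    + move=> F ndF HF; have mF n : measurable (F n) by case: (HF n).
      split; first exact: bigcup_measurable.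
      (* The increments of an increasing sequence are disjoint members of [H], so countable
         additivity handles the union. *)
      have HDF n : H (seqD F n).
        case: n => [|n] /=; first exact: HF.
        by apply: HD => //; exact/subsetPset/ndF.
      rewrite -eq_bigcup_seqD integral_bigcup.
      * by rewrite eseries0// => n _ _; case: (HDF n).
      * exact: trivIset_seqD.
      * by move=> n; case: (HDF n).
      * by rewrite eq_bigcup_seqD; apply: ihA; exact: bigcup_measurable.
  - by move=> A VA; split; [case: VA|exact: indic_limit_integral0 VA].
have h0 A : measurable A -> (\int[P]_(x in A) (h x)%:E = 0)%E.
  move=> /mG GA; have [] // : H A.
  by apply: subH; apply: (smallest_sub _ _) GA;
    [exact: smallest_sigma_algebra|move=> B /GV; exact: sub_sigma_algebra].
have : ae_eq P setT (EFin \o h) (cst 0%E).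
  apply: integral_ae_eq => // E _ mE.
  by rewrite h0// integral0.
by apply: filterS => x /= /(_ I) [].
Qed.

End function_algebra.

Arguments indic_limitC {d T R P V A}.
Arguments indic_limitI {d T R P V A B}.
Arguments indic_limitT {d T R P V}.
Arguments indic_limit_ae {d T R P V A B}.
Arguments indic_limit_gt0 {d T R P V f}.

(** * Trigonometric polynomials on the torus *)

Section trig_poly.
Context {R : realType} {d : nat}.
Implicit Types (m n : d.-tuple int) (x : torus R d).

Definition addz m n : d.-tuple int := [tuple tnth m i + tnth n i | i < d].
Definition subz m n : d.-tuple int := [tuple tnth m i - tnth n i | i < d].
Definition zeroz : d.-tuple int := [tuple 0 | i < d].
Definition unitz (i : 'I_d) : d.-tuple int := [tuple ((j == i) : nat)%:Z | j < d].

Definition tcos m x : R := cos (2 * pi * dotZ x m).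
Definition tsin m x : R := sin (2 * pi * dotZ x m).

Lemma dotZD x m n : dotZ x (addz m n) = dotZ x m + dotZ x n.
Proof.
rewrite /dotZ -big_split; apply: eq_bigr => i _ /=.
by rewrite tnth_mktuple rmorphD mulrDr.
Qed.

Lemma dotZB x m n : dotZ x (subz m n) = dotZ x m - dotZ x n.
Proof.
rewrite /dotZ -sumrB; apply: eq_bigr => i _ /=.
by rewrite tnth_mktuple rmorphB mulrBr.
Qed.

Lemma dotZ_zero x : dotZ x zeroz = 0.
Proof. by rewrite /dotZ big1// => i _; rewrite tnth_mktuple mulr0. Qed.

Lemma dotZ_unit x i : dotZ x (unitz i) = tnth x i.
Proof.
rewrite /dotZ (bigD1 i)//= tnth_mktuple eqxx mulr1 big1 ?addr0// => j ji.
by rewrite tnth_mktuple (negbTE ji) mulr0.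
Qed.

Lemma tcosD m n x : tcos (addz m n) x = tcos m x * tcos n x - tsin m x * tsin n x.
Proof. by rewrite /tcos dotZD mulrDr cosD. Qed.
Lemma tcosB m n x : tcos (subz m n) x = tcos m x * tcos n x + tsin m x * tsin n x.
Proof. by rewrite /tcos dotZB mulrBr cosB. Qed.
Lemma tsinD m n x : tsin (addz m n) x = tsin m x * tcos n x + tcos m x * tsin n x.
Proof. by rewrite /tsin dotZD mulrDr sinD. Qed.
Lemma tsinB m n x : tsin (subz m n) x = tsin m x * tcos n x - tcos m x * tsin n x.
Proof. by rewrite /tsin dotZB mulrBr sinB. Qed.

Lemma tcosM m n x :
  tcos m x * tcos n x = 1 / 2 * (tcos (addz m n) x + tcos (subz m n) x).
Proof. by rewrite tcosD tcosB; field. Qed.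
(** The subtraction is written with [-1 *] to match the shape produced by the constructors of
    [trig_poly]. *)
Lemma tsinM m n x :
  tsin m x * tsin n x = 1 / 2 * (tcos (subz m n) x + -1 * tcos (addz m n) x).
Proof. by rewrite tcosD tcosB; field. Qed.
Lemma tsin_tcosM m n x :
  tsin m x * tcos n x = 1 / 2 * (tsin (addz m n) x + tsin (subz m n) x).
Proof. by rewrite tsinD tsinB; field. Qed.

Lemma measurable_dotZ m : measurable_fun setT (fun x => dotZ x m).
Proof.
apply: measurable_sum => i; apply: measurable_funM => //.
exact: (@measurable_tnth _ (measurableTypeR R)).
Qed.

Lemma measurable_tcos m : measurable_fun setT (tcos m).
Proof.
apply: (measurableT_comp (continuous_measurable_fun (@continuous_cos R))).
by apply: measurable_funM => //; exact: measurable_dotZ.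
Qed.

Lemma measurable_tsin m : measurable_fun setT (tsin m).
Proof.
apply: (measurableT_comp (continuous_measurable_fun (@continuous_sin R))).
by apply: measurable_funM => //; exact: measurable_dotZ.
Qed.

(** The span of the sines and cosines, given inductively so that linear identities for integrals
    extend to it by induction. *)
Inductive trig_poly : (torus R d -> R) -> Prop :=
| trig_cos m : trig_poly (tcos m)
| trig_sin m : trig_poly (tsin m)
| trigZ a f : trig_poly f -> trig_poly (fun x => a * f x)
| trigD f g : trig_poly f -> trig_poly g -> trig_poly (fun x => f x + g x).

Lemma trig_polyM f g : trig_poly f -> trig_poly g -> trig_poly (fun x => f x * g x).
Proof.
move=> Vf Vg.
(* Linearity in [g] reduces to multiplication by one cosine or sine; linearity in [f] then leaves
   products of two such functions, where the product-to-sum formulas apply. *)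
suff [h1 h2] : (forall m, trig_poly (fun x => f x * tcos m x)) /\
               (forall m, trig_poly (fun x => f x * tsin m x)).
  elim: Vg => {g} [//|//|a g _ IH|g k _ IHg _ IHk].
  - under eq_fun do rewrite mulrCA; exact: trigZ.
  - under eq_fun do rewrite mulrDr; exact: trigD.
elim: Vf => {f} [n|n|a f _ [IH1 IH2]|f k _ [IH1 IH2] _ [IH3 IH4]]; split => m.
- under eq_fun do rewrite tcosM.
  by apply/trigZ/trigD; exact: trig_cos.
- under eq_fun do rewrite mulrC tsin_tcosM.
  by apply/trigZ/trigD; exact: trig_sin.
- under eq_fun do rewrite tsin_tcosM.
  by apply/trigZ/trigD; exact: trig_sin.
- under eq_fun do rewrite tsinM.
  by apply/trigZ/trigD; [|apply: trigZ]; exact: trig_cos.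
- by under eq_fun do rewrite -mulrA; exact: trigZ.
- by under eq_fun do rewrite -mulrA; exact: trigZ.
- by under eq_fun do rewrite mulrDl; exact: trigD.
- by under eq_fun do rewrite mulrDl; exact: trigD.
Qed.

Lemma trig_poly_cst a : trig_poly (cst a).
Proof.
have -> : cst a = fun x => a * tcos zeroz x.
  by apply/funext => x; rewrite /tcos dotZ_zero mulr0 cos0 mulr1.
exact/trigZ/trig_cos.
Qed.

Lemma bounded_algebra_trig_poly : bounded_algebra trig_poly.
Proof.
split.
- exact: trig_poly_cst.
- by move=> a f; exact: trigZ.
- exact: trigD.
- exact: trig_polyM.
- move=> f; elim => {f} [m|m|a f _ [mf [M fM]]|f g _ [mf [M fM]] _ [mg [N gN]]].
  + by split; [exact: measurable_tcos|exists 1 => x; exact: cos_max].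
  + by split; [exact: measurable_tsin|exists 1 => x; exact: sin_max].
  + split; first exact: measurable_funM.
    by exists (`|a| * M) => x; rewrite normrM ler_wpM2l.
  + split; first exact: measurable_funD.
    exists (M + N) => x; exact: le_trans (ler_normD _ _) (lerD (fM x) (gN x)).
Qed.

End trig_poly.

(** * The open cube, generators of the sigma-algebra, and half-spaces *)

Section torus_measure.
Context {R : realType}.

(** Open, so that [2 pi x_i] stays strictly between [-pi] and [pi], where [sin (2 pi x_i)] has the
    sign of [x_i]. *)
Definition cube d : set (torus R d) :=
  [set x | forall i, tnth x i \in `](- (1 / 2)), (1 / 2)[].

Lemma measurable_cube d : measurable (cube d).
Proof.
rewrite (_ : cube d = \bigcap_(i in [set: 'I_d])
    ([set: torus R d] `&` (fun x => tnth x i) @^-1` `](- (1 / 2)), (1 / 2)[%classic)).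
  apply: fin_bigcap_measurable => // i _.
  exact: (@measurable_tnth _ (measurableTypeR R)).
by apply/seteqP; split => x /= xQ i => [_|]; [split => //; exact: xQ|
  case: (xQ i I)].
Qed.

Lemma unifT_itv : unifT R `](- (1 / 2)), (1 / 2)[%classic = 1%E.
Proof.
rewrite /unifT/= /uniform_prob (eq_integral (fun=> 1%E)); last first.
  move=> x; rewrite inE/= in_itv/= => /andP[x1 x2].
  by rewrite /uniform_pdf !ltW//= opprK -splitr invr1.
rewrite integral_cst//= lebesgue_measure_itv/= lte_fin half_lt mul1e.
by rewrite -EFinB opprK -splitr.
Qed.

Lemma torus_prob_cube d : torus_prob R d (cube d) = 1%E.
Proof.
elim: d => [|d IH].
  by rewrite /= diracE mem_set// => -[].
rewrite /= /distribution /pushforward/=.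
rewrite (_ : _ @^-1` _ = `](- (1 / 2)), (1 / 2)[%classic `*` cube d); last first.
  apply/seteqP; split => -[x t] /=.
    move=> h; split; first by have := h ord0; rewrite tnth0.
    by move=> i; have := h (lift ord0 i); rewrite tnthS.
  case=> hx ht i; case: (unliftP ord0 i) => [j|] ->.
    by rewrite tnthS; exact: ht.
  by rewrite tnth0.
rewrite product_measure1E//=; last exact: measurable_cube.
by rewrite [X in (_ * X)%E]IH mule1 unifT_itv.
Qed.

Lemma torus_prob_ae_cube d : {ae torus_prob R d, forall x, cube d x}.
Proof.
have mQ := measurableC (measurable_cube d).
have Q0 : torus_prob R d (~` cube d) = 0%E.
  rewrite probability_setC; last exact: measurable_cube.
  by rewrite torus_prob_cube -EFinB subrr.
exact/(negligibleP _ mQ).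
Qed.

Definition torus_rays d : set (set (torus R d)) :=
  [set A | exists i a, A = [set x | a < tnth x i]].

(** The coordinates generate the product sigma-algebra and open rays generate the Borel sets of the
    line, so it is enough that each coordinate is measurable for the sigma-algebra of the
    half-spaces. *)
Lemma measurable_torus_rays d : measurable `<=` <<s torus_rays d >>.
Proof.
move=> A mA; apply: (smallest_sub _ _) mA; first exact: smallest_sigma_algebra.
rewrite -bigcup_seq => B /= [i _ [C mC <-]].
have : measurable_fun [set: g_sigma_algebraType (torus_rays d)]
    (fun x : torus R d => tnth x i : measurableTypeR R).
  apply: (measurability _ (RGenOInfty.measurableE R)) => _ [_ [a ->] <-].
  apply: sub_sigma_algebra; exists i, a.
  by rewrite setTI; apply/seteqP; split => x /=; rewrite in_itv/= andbT.
by move=> /(_ measurableT C mC).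
Qed.

(** On the cube [sin (2 pi x_i)] has the sign of [x_i], and [cos (2 pi x_i)] is strictly decreasing
    in [|x_i|]. Boolean combinations of positivity sets thus recover each half-space up to a null
    set. *)
Lemma indic_limit_rays d : torus_rays d `<=` indic_limit (torus_prob R d) trig_poly.
Proof.
move=> _ [i [a ->]]; have bV := @bounded_algebra_trig_poly R d.
have mi : measurable (`]a, +oo[%classic : set (measurableTypeR R)).
  exact: measurable_itv.
have mA : measurable [set x : torus R d | a < tnth x i].
  have := @measurable_tnth _ (measurableTypeR R) d i measurableT _ mi.
  congr measurable; rewrite setTI.
  by apply/seteqP; split => x /=; rewrite in_itv/= andbT.
have pi0 := @pi_gt0 R.
pose c := @tcos R d (unitz i); pose s := @tsin R d (unitz i).
have s0 : indic_limit (torus_prob R d) trig_poly [set x | 0 < s x].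
  exact/indic_limit_gt0/trig_sin.
have s0' : indic_limit (torus_prob R d) trig_poly [set x | 0 < -1 * s x].
  exact/indic_limit_gt0/trigZ/trig_sin.
have ca t : indic_limit (torus_prob R d) trig_poly [set x | 0 < c x + t].
  apply: indic_limit_gt0 => //; apply: trigD; first exact: trig_cos.
  exact: trig_poly_cst.
have ca' t : indic_limit (torus_prob R d) trig_poly [set x | 0 < t + -1 * c x].
  apply: indic_limit_gt0 => //; apply: trigD; first exact: trig_poly_cst.
  exact/trigZ/trig_cos.
have cosE x : c x = cos (2 * pi * `|tnth x i|).
  rewrite /c /tcos dotZ_unit; case: ger0P => // _.
  by rewrite mulrN cosN.
have aeq := @torus_prob_ae_cube d.
(* Beyond the faces of the cube the half-space is almost everything or almost nothing. *)
have [a1|a1] := leP a (- (1 / 2)).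
  apply: (indic_limit_ae mA _ (indic_limitT bV)); apply: filterS aeq => x Qx.
  split => //= _; have := Qx i; rewrite in_itv/= => /andP[? _].
  exact: le_lt_trans a1 _.
have [a2|a2] := leP (1 / 2) a.
  apply: (indic_limit_ae mA _ (indic_limitC bV (indic_limitT bV))).
  apply: filterS aeq => x Qx.
  split => [[]//|/= ax]; have := Qx i; rewrite in_itv/= => /andP[_ ?]; lra.
have pos x : 0 < tnth x i -> cube d x -> 0 < s x.
  move=> x0 /(_ i); rewrite in_itv/= => /andP[_ x1].
  rewrite /s /tsin dotZ_unit; apply: sin_gt0_pi; apply/andP; split.
    by rewrite !mulr_gt0.
  by have := ltr_pM2l pi0 (tnth x i) (1 / 2); rewrite x1; lra.
have neg x : tnth x i < 0 -> cube d x -> s x < 0.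
  move=> x0 /(_ i); rewrite in_itv/= => /andP[x1 _].
  rewrite /s /tsin dotZ_unit -oppr_gt0 -sinN; apply: sin_gt0_pi; apply/andP; split.
    by rewrite -mulrN !mulr_gt0// oppr_gt0.
  by have := ltr_pM2l pi0 (- (1 / 2)) (tnth x i); rewrite x1; lra.
have zer x : tnth x i = 0 -> s x = 0.
  by move=> x0; rewrite /s /tsin dotZ_unit x0 mulr0 sin0.
have sgt x : cube d x -> (0 < s x) = (0 < tnth x i).
  move=> Qx; case: (ltgtP 0 (tnth x i)) => x0.
  - exact: pos.
  - by apply/negbTE; rewrite -leNgt ltW// neg.
  - by rewrite zer// ltxx.
have slt x : cube d x -> (s x < 0) = (tnth x i < 0).
  move=> Qx; case: (ltgtP 0 (tnth x i)) => x0.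
  - by apply/negbTE; rewrite -leNgt ltW// pos.
  - exact: neg.
  - by rewrite zer// ltxx.
have ltc x : cube d x -> ((c x < cos (2 * pi * `|a|)) = (`|a| < `|tnth x i|)) *
    ((cos (2 * pi * `|a|) < c x) = (`|tnth x i| < `|a|)).
  move=> /(_ i); rewrite in_itv/= => /andP[x1 x2].
  have h (y : R) : `|y| < 1 / 2 -> 2 * pi * `|y| \in `[0, pi].
    move=> y1; rewrite in_itv/= !mulr_ge0 ?(ltW pi0)//=.
    by have := ltr_pM2l pi0 `|y| (1 / 2); rewrite y1; lra.
  have ha : `|a| < 1 / 2 by rewrite ltr_norml a1.
  have hx : `|tnth x i| < 1 / 2 by rewrite ltr_norml x1.
  by rewrite cosE !ltr_cos ?h// !ltr_pM2l ?mulr_gt0.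
(* For [a >= 0], [x_i > a] means that the sine is positive and [|x_i| > |a|]. *)
have [a0|a0] := leP 0 a.
  apply: (indic_limit_ae mA _ (indic_limitI bV s0 (ca' (cos (2 * pi * `|a|))))).
  apply: filterS aeq => x Qx /=.
  rewrite mulN1r subr_gt0 ltc// sgt// (ger0_norm a0).
  split => [[x0]|ax]; first by rewrite gtr0_norm.
  by have x0 := le_lt_trans a0 ax; rewrite gtr0_norm.
(* For [a < 0] the complement is described: [x_i <= a] means that the sine is negative and
   [|x_i| < |a|] fails. *)
apply: (indic_limit_ae mA _ (indic_limitC bV (indic_limitI bV s0'
   (indic_limitC bV (ca (- cos (2 * pi * `|a|))))))).
apply: filterS aeq => x Qx /=.
rewrite mulN1r oppr_gt0 slt// subr_gt0 ltc//.
split => [h|ax [x0]]; last by apply; rewrite !ltr0_norm// ltrN2.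
rewrite ltNge; apply/negP => xa; apply: h; have x0 := le_lt_trans xa a0.
by split => //; apply/negP; rewrite -leNgt !ltr0_norm// lerN2.
Qed.

End torus_measure.

(** * Orthogonality relations *)

Section bounded_integral.
Context {d} {T : measurableType d} {R : realType} (P : probability T R).
Implicit Types (f g h : T -> R).

Lemma bounded_integrable f (M : R) : measurable_fun setT f ->
  (forall x, `|f x| <= M) -> P.-integrable setT (EFin \o f).
Proof.
move=> mf fM; apply: measurable_bounded_integrable => //.
  by rewrite -ge0_fin_numE// fin_num_measure.
by exists M; split => [|N MN x _ /=]; rewrite ?num_real// (le_trans (fM x))// ltW.
Qed.

Lemma integrable_bounded_mul h g (M : R) : P.-integrable setT (EFin \o h) ->
  measurable_fun setT g -> (forall x, `|g x| <= M) ->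
  P.-integrable setT (fun x => (h x * g x)%:E).
Proof.
move=> ih mg gM; apply: (integrableMl measurableT ih mg).
by exists M; split => [|N MN x _ /=]; rewrite ?num_real// (le_trans (gM x))// ltW.
Qed.

Lemma bounded_cvg_Rintegral (f_ : nat -> T -> R) f (M : R) :
  (forall n, measurable_fun setT (f_ n)) -> measurable_fun setT f ->
  (forall n x, `|f_ n x| <= M) -> (forall x, f_ n x @[n --> \oo] --> f x) ->
  Rintegral P setT (f_ n) @[n --> \oo] --> Rintegral P setT f.
Proof.
move=> mf_ mf fM ff.
have [|||||ifE _ h] := @dominated_convergence _ _ _ P setT measurableT
   (fun n x => (f_ n x)%:E) (EFin \o f) (cst M%:E).
- by move=> n; exact/measurable_EFinP.
- exact/measurable_EFinP.
- by apply: nearW => x _; apply: cvg_EFin; [exact: nearW|exact: ff].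
- exact: finite_measure_integrable_cst.
- by apply: nearW => x n _ /=; rewrite lee_fin.
apply: fine_cvg; move: h; rewrite fineK//.
exact: integrable_fin_num.
Qed.

End bounded_integral.

Section orthogonality.
Context {R : realType}.

Lemma sin_pi_int (k : int) : sin (pi * k%:~R) = 0 :> R.
Proof.
have h (n : nat) : sin (pi * n%:R) = 0 :> R.
  elim: n => [|n IH]; first by rewrite mulr0 sin0.
  by rewrite -natr1 mulrDr mulr1 sinD IH mul0r sinpi mulr0 addr0.
case: k => n; first exact: h.
by rewrite NegzE mulrNz mulrN sinN h oppr0.
Qed.

Lemma Rintegral_unifT_deriv (f F : R -> R) : (forall x : R, is_derive x 1 F (f x)) ->
  continuous f -> (forall x, `|f x| <= 1) ->
  Rintegral (unifT R) setT f = F (1 / 2) - F (- (1 / 2)).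
Proof.
move=> dF cf f1.
have mf : measurable_fun setT f by exact: continuous_measurable_fun.
have mf1 : measurable_fun setT (fun x => 1 + f x) by exact: measurable_funD.
have if_ : (unifT R).-integrable setT (EFin \o f).
  exact: (bounded_integrable (unifT R) f 1 mf f1).
pose G x := x + F x.
have dG (x : R) : is_derive x 1 G (1 + f x) by exact: is_deriveD.
have cG : continuous G.
  by move=> x; apply/differentiable_continuous/derivable1_diffP; exact: ex_derive.
(* The added 1 makes the integrand nonnegative, as required for passing to an integral over the
   interval; it contributes 1 to both sides since the mass is 1. *)
suff : Rintegral (unifT R) setT (fun x => 1 + f x) = 1 + (F (1 / 2) - F (- (1 / 2))).
  rewrite RintegralD//; last first.
    by apply: (bounded_integrable (unifT R) (cst 1) 1) => // x; rewrite normr1.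
  by rewrite Rintegral_cst// [X in fine X](probability_setT (unifT R)) mulr1 => /addrI.
rewrite /Rintegral integral_uniform//; last 2 first.
- exact/measurable_EFinP.
- move=> x; rewrite lee_fin; have := f1 x; rewrite ler_norml => /andP[? _].
  by rewrite -lerBlDl sub0r.
rewrite (@continuous_FTC2 _ _ G); first last.
- by move=> x _; rewrite derive1E derive_val.
- split.
  + by move=> x _; exact: ex_derive.
  + by apply: cvg_at_right_filter; exact: cG.
  + by apply: cvg_at_left_filter; exact: cG.
- apply: continuous_subspaceT => x; apply: continuousD; [exact: cst_continuous|exact: cf].
- exact: half_lt.
by rewrite -EFinB -EFinM /= /G; field.
Qed.

Lemma is_derive_sinM (w x : R) :
  is_derive x 1 (fun x => sin (w * x)) (w * cos (w * x)).
Proof.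
have dw : is_derive x 1 (w *: (id : R -> R)) (w *: 1) by exact: is_deriveZ.
apply: (is_derive_eq (is_derive1_comp (is_derive_sin (w * x)) dw)).
by rewrite /GRing.scale/= mulr1 mulrC ?mulrN.
Qed.

Lemma is_derive_cosM (w x : R) :
  is_derive x 1 (fun x => cos (w * x)) (- (w * sin (w * x))).
Proof.
have dw : is_derive x 1 (w *: (id : R -> R)) (w *: 1) by exact: is_deriveZ.
apply: (is_derive_eq (is_derive1_comp (is_derive_cos (w * x)) dw)).
by rewrite /GRing.scale/= mulr1 mulrC ?mulrN.
Qed.

Lemma Rintegral_unifT_trig (k : int) :
  Rintegral (unifT R) setT (fun x => cos (2 * pi * (x * k%:~R))) = (k == 0)%:R /\
  Rintegral (unifT R) setT (fun x => sin (2 * pi * (x * k%:~R))) = 0.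
Proof.
have pi0 := @pi_gt0 R.
have [->|k0] := eqVneq k 0.
  split.
    under eq_Rintegral do rewrite !mulr0 cos0.
    by rewrite Rintegral_cst// [X in fine X](probability_setT (unifT R)) mulr1.
  under eq_Rintegral do rewrite !mulr0 sin0.
  by rewrite Rintegral_cst// mul0r.
pose w : R := 2 * pi * k%:~R.
have w0 : w != 0 by rewrite !mulf_neq0 ?intr_eq0// gt_eqF.
have E x : 2 * pi * (x * k%:~R) = w * x by rewrite /w; ring.
(* This makes the primitive [sin (w x) / w] vanish at both endpoints; for the sine integrand the
   primitive is even, so its endpoint values agree. *)
have wh : w * (1 / 2) = pi * k%:~R by rewrite /w; field.
have cw : continuous ( *%R w) by exact: mulrl_continuous.
split; under eq_Rintegral do rewrite E.
  have dF (x : R) : is_derive x 1 (fun x => w^-1 * sin (w * x)) (cos (w * x)).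
    have -> : cos (w * x) = w^-1 *: (w * cos (w * x)).
      by rewrite /GRing.scale/= mulKf.
    by apply: is_deriveZ; exact: is_derive_sinM.
  have -> := @Rintegral_unifT_deriv _ _ dF.
  - by rewrite mulrN sinN wh sin_pi_int oppr0 mulr0 subrr.
  - by move=> x; apply: continuous_comp; [exact: cw|exact: continuous_cos].
  - by move=> x; exact: cos_max.
have dF (x : R) : is_derive x 1 (fun x => - w^-1 * cos (w * x)) (sin (w * x)).
  have -> : sin (w * x) = - w^-1 *: (- (w * sin (w * x))).
    by rewrite /GRing.scale/= mulrNN mulKf.
  by apply: is_deriveZ; exact: is_derive_cosM.
have -> := @Rintegral_unifT_deriv _ _ dF.
- by rewrite mulrN cosN subrr.
- by move=> x; apply: continuous_comp; [exact: cw|exact: continuous_sin].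
- by move=> x; exact: sin_max.
Qed.

(** Change of variables along [tcons], then Fubini. The bound [M] gives integrability on the product
    and on each slice, so the inner [fine] loses nothing. *)
Lemma Rintegral_torusS d (F : torus R d.+1 -> R) (M : R) :
  measurable_fun setT F -> (forall x, `|F x| <= M) ->
  Rintegral (torus_prob R d.+1) setT F =
  Rintegral (unifT R) setT (fun x =>
    Rintegral (torus_prob R d) setT (fun y => F (tcons (x, y)))).
Proof.
move=> mF FM.
have mT : measurable_fun setT (F \o @tcons R d).
  by apply: measurableT_comp => //; exact: measurable_tcons.
have iF : (unifT R \x torus_prob R d)%E.-integrable setT (EFin \o (F \o @tcons R d)).
  exact: (bounded_integrable (unifT R \x torus_prob R d)%E _ M mT (fun p => FM _)).
rewrite /Rintegral /= /distribution integral_pushforward//; last exact/measurable_EFinP.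
rewrite preimage_setT -integral12_prod_meas1//.
congr fine; apply: eq_integral => x _; rewrite /fubini_F fineK//.
apply: integrable_fin_num => //.
apply: (bounded_integrable (torus_prob R d) (fun y => F (tcons (x, y))) M) => //.
exact: (measurableT_comp mT (measurable_pair1 x)).
Qed.

Lemma dotZ_cons d (x : R) (y : torus R d) (m : d.+1.-tuple int) :
  dotZ (tcons (x, y)) m = x * (thead m)%:~R + dotZ y (behead_tuple m).
Proof.
rewrite /dotZ big_ord_recl tnth0; congr (_ + _); apply: eq_bigr => i _.
rewrite tnthS tnth_behead; congr (_ * (tnth m _)%:~R); apply/val_inj.
by rewrite /= inordK// ltnS.
Qed.

(** Induction on the dimension with the addition formulas: the sine integral over the remaining
    coordinates is 0, leaving the first-coordinate integral times the Kronecker delta of the other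
    frequencies. *)
Lemma Rintegral_trig d (m : d.-tuple int) :
  Rintegral (torus_prob R d) setT (tcos m) = (m == zeroz)%:R /\
  Rintegral (torus_prob R d) setT (tsin m) = 0.
Proof.
elim: d m => [|d IH] m.
  have m0 x : dotZ x m = 0 by rewrite /dotZ big_ord0.
  have -> : m == zeroz by rewrite tuple0 [eqbRHS]tuple0.
  rewrite /tcos /tsin; split; under eq_Rintegral do rewrite m0 mulr0 ?cos0 ?sin0.
    by rewrite Rintegral_cst// [X in fine X](probability_setT (torus_prob R 0)) mulr1.
  by rewrite Rintegral_cst// mul0r.
have [c1 s1] := Rintegral_unifT_trig (thead m).
have [c2 s2] := IH (behead_tuple m).
have ic := bounded_integrable (torus_prob R d) _ 1 (measurable_tcos (behead_tuple m))
   (fun x => cos_max _).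
have is_ := bounded_integrable (torus_prob R d) _ 1 (measurable_tsin (behead_tuple m))
   (fun x => sin_max _).
have mk : measurable_fun setT (fun x : measurableTypeR R => 2 * pi * (x * (thead m)%:~R)).
  by apply: measurable_funM => //; exact: measurable_funM.
have u0 : (unifT R).-integrable setT (EFin \o (fun x => cos (2 * pi * (x * (thead m)%:~R)))).
  apply: (bounded_integrable (unifT R) _ 1) => [|x]; last exact: cos_max.
  exact: (measurableT_comp (continuous_measurable_fun (@continuous_cos R)) mk).
have u1 : (unifT R).-integrable setT (EFin \o (fun x => sin (2 * pi * (x * (thead m)%:~R)))).
  apply: (bounded_integrable (unifT R) _ 1) => [|x]; last exact: sin_max.
  exact: (measurableT_comp (continuous_measurable_fun (@continuous_sin R)) mk).
split.
  rewrite (Rintegral_torusS d _ 1 (measurable_tcos m) (fun x => cos_max _)).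
  under eq_Rintegral => x _.
    under eq_Rintegral => y _.
      rewrite /tcos dotZ_cons mulrDr cosD -/(tcos (behead_tuple m) y).
      rewrite -/(tsin (behead_tuple m) y).
      over.
    rewrite RintegralB//; first last.
    - exact: (integrableZl measurableT _ is_).
    - exact: (integrableZl measurableT _ ic).
    rewrite !RintegralZl// c2 s2 mulr0 subr0.
    over.
  rewrite RintegralZr// c1 -natrM mulnb; congr (nat_of_bool _)%:R.
  apply/andP/eqP => [[/eqP h /eqP b]|->].
    apply: eq_from_tnth => i; rewrite tnth_mktuple.
    case: (unliftP ord0 i) => [j|] -> //.
    have := congr1 (fun t => tnth t j) b; rewrite tnth_behead tnth_mktuple.
    by move=> <-; congr tnth; apply/val_inj; rewrite /= inordK// ltnS.
  rewrite /thead tnth_mktuple eqxx; split => //; apply/eqP/eq_from_tnth => i.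
  by rewrite tnth_behead !tnth_mktuple.
rewrite (Rintegral_torusS d _ 1 (measurable_tsin m) (fun x => sin_max _)).
under eq_Rintegral => x _.
  under eq_Rintegral => y _.
    rewrite /tsin dotZ_cons mulrDr sinD -/(tcos (behead_tuple m) y).
    rewrite -/(tsin (behead_tuple m) y).
    over.
  rewrite RintegralD//; first last.
  - exact: (integrableZl measurableT _ is_).
  - exact: (integrableZl measurableT _ ic).
  rewrite !RintegralZl// c2 s2 mulr0 addr0.
  over.
by rewrite RintegralZr// s1 mul0r.
Qed.

End orthogonality.

(** * Sums of Fourier series *)

(** By linearity [h] is orthogonal to all trigonometric polynomials, and these approximate the
    half-spaces that generate the sigma-algebra. *)
Lemma torus_fourier_eq0 (R : realType) d (h : torus R d -> R) :
  (torus_prob R d).-integrable setT (EFin \o h) ->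
  (forall m, Rintegral (torus_prob R d) setT (fun x => h x * tcos m x) = 0) ->
  (forall m, Rintegral (torus_prob R d) setT (fun x => h x * tsin m x) = 0) ->
  {ae torus_prob R d, forall x, h x = 0}.
Proof.
move=> ih hc hs; have bV := @bounded_algebra_trig_poly R d.
have ihg g : trig_poly g -> (torus_prob R d).-integrable setT (fun x => (h x * g x)%:E).
  case: bV => _ _ _ _ /[apply] -[mg [M gM]].
  exact: (integrable_bounded_mul (torus_prob R d) _ _ M).
apply: (indic_limit_ae0 (torus_prob R d) trig_poly h (torus_rays d)) => //.
- move=> g; elim => {g} [//|//|a g tg IH|g k tg IHg tk IHk].
  + under eq_Rintegral do rewrite mulrCA.
    by rewrite RintegralZl ?IH ?mulr0//; exact: ihg.
  + under eq_Rintegral do rewrite mulrDr.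
    by rewrite RintegralD ?IHg ?IHk ?addr0//; exact: ihg.
- exact: measurable_torus_rays.
- exact: indic_limit_rays.
Qed.

(** * Sums over a countable type as series *)

Section enumerated_sum.
Context {R : realType} {T : countType}.
Implicit Types (w : T -> R) (k n : nat).

(** Numbers that encode no element get the term 0. *)
Definition enum_term w k : R := oapp w 0 (pickle_inv k).

Lemma enum_termD w v k : enum_term (fun t => w t + v t) k = enum_term w k + enum_term v k.
Proof. by rewrite /enum_term; case: pickle_inv => //=; rewrite addr0. Qed.

Lemma enum_term_norm w k : `|enum_term w k| = enum_term (fun t => `|w t|) k.
Proof. by rewrite /enum_term; case: pickle_inv => //=; rewrite normr0. Qed.

Lemma le_enum_term w v k : (forall t, w t <= v t) -> enum_term w k <= enum_term v k.
Proof. by move=> wv; rewrite /enum_term; case: pickle_inv => //=. Qed.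

(** Only the index [pickle p] decodes to [p], so all other terms are 0. *)
Lemma series_enum_delta w p n : (pickle p < n)%N ->
  series (enum_term (fun t => w t * (t == p)%:R)) n = w p.
Proof.
move=> pn; rewrite /series/= big_mkord (bigD1 (Ordinal pn))//=.
rewrite {1}/enum_term pickleK_inv/= eqxx mulr1 big1 ?addr0// => k kp.
rewrite /enum_term; case E: pickle_inv => [t|]//=.
have [tp|] := eqVneq t p; last by rewrite mulr0.
have := @pickle_invK T k; rewrite E/= tp => kE.
by move: kp; rewrite -val_eqE /= kE eqxx.
Qed.

Lemma cvg_series_enum_delta w p :
  series (enum_term (fun t => w t * (t == p)%:R)) @ \oo --> w p.
Proof.
apply: cvg_near_cst; exists (pickle p).+1 => // n /= pn.
exact: series_enum_delta.
Qed.

Lemma series_enum_le_esum w n : (forall t, 0 <= w t) ->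
  ((series (enum_term w) n)%:E <= \esum_(t in setT) (w t)%:E)%E.
Proof.
move=> w0; have e0 k : 0 <= enum_term w k.
  by rewrite /enum_term; case: pickle_inv => //=.
rewrite /series/= -sumEFin.
apply: (@le_trans _ _ (\sum_(0 <= k <oo) (enum_term w k)%:E)%E).
  by apply: nneseries_lim_ge => k _; rewrite lee_fin.
rewrite nneseries_esumT; last by move=> k; rewrite lee_fin.
have -> : \esum_(t in [set: T]) (w t)%:E =
    \esum_(t in [set: T]) (enum_term w (pickle t))%:E.
  by apply: eq_esum => t _; rewrite /enum_term pickleK_inv.
(* The encoding is injective, so the sum over [T] becomes one over its image; outside the image the
   terms are 0. *)
rewrite -(@esum_image R T nat setT pickle (fun k => (enum_term w k)%:E)).
  rewrite [leRHS]esum_mkcond; apply: le_esum => k _.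
  case: ifPn => //; rewrite notin_setE/= => kT; rewrite lee_fin.
  rewrite /enum_term; case E: pickle_inv => [t|]//=.
  exfalso; apply: kT; exists t => //.
  by have := @pickle_invK T k; rewrite E.
by move=> x y _ _; exact: (pcan_inj pickleK).
Qed.

End enumerated_sum.

(** * Absolutely convergent cosine series and their coefficients *)

Section fourier_series.
Context {R : realType} {d : nat} (a : d.-tuple int -> R).
Hypothesis sa : summable setT (fun m => (a m)%:E).
Let P := torus_prob R d.
Let A : R := fine (\esum_(m in setT) `|(a m)%:E|)%E.

(** For coefficients that are real and even in [m], the sines of [m] and [-m] cancel, so this is the
    Fourier series. *)
Definition cos_series n (x : torus R d) : R :=
  series (enum_term (fun m => a m * tcos m x)) n.

Definition cos_sum (x : torus R d) : R := limn (cos_series ^~ x).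

Let series_norm_le n : series (enum_term (fun m => `|a m|)) n <= A.
Proof.
rewrite -lee_fin /A fineK; first exact: series_enum_le_esum.
by move: sa; rewrite summableE.
Qed.

Lemma cos_series_bound n x : `|cos_series n x| <= A.
Proof.
rewrite (le_trans _ (series_norm_le n))// (le_trans (ler_norm_sum _ _ _))//.
apply: ler_sum => k _; rewrite enum_term_norm; apply: le_enum_term => m.
by rewrite normrM -[leRHS]mulr1 ler_wpM2l// cos_max.
Qed.

Lemma cos_series_cvg x : cos_series n x @[n --> \oo] --> cos_sum x.
Proof.
apply: normed_cvg; rewrite /normed_series_of/=.
apply: nondecreasing_is_cvgn.
  by apply: nondecreasing_series => k _; rewrite normr_ge0.
exists A => _ [n _ <-]; apply: (le_trans _ (series_norm_le n)).
apply: ler_sum => k _ /=; rewrite enum_term_norm; apply: le_enum_term => m.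
by rewrite normrM -[leRHS]mulr1 ler_wpM2l// cos_max.
Qed.

Lemma cos_sum_bound x : `|cos_sum x| <= A.
Proof.
have h : `|cos_series n x| @[n --> \oo] --> `|cos_sum x|.
  by apply: cvg_norm; exact: cos_series_cvg.
rewrite -(cvg_lim _ h)//; apply: limr_le; first by apply/cvg_ex; eexists; exact: h.
by apply: nearW => n; exact: cos_series_bound.
Qed.

Lemma measurable_cos_series n : measurable_fun setT (cos_series n).
Proof.
rewrite /cos_series /series/=; apply: measurable_sum => k.
rewrite /enum_term; case: pickle_inv => [m|]/=; last exact: measurable_cst.
by apply: measurable_funM => //; exact: measurable_tcos.
Qed.

Lemma measurable_cos_sum : measurable_fun setT cos_sum.
Proof.
apply: (measurable_fun_cvg measurable_cos_series) => x _.
exact: cos_series_cvg.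
Qed.

Lemma Rintegral_cos_series (g : torus R d -> R) (M : R) n :
  measurable_fun setT g -> (forall x, `|g x| <= M) ->
  Rintegral P setT (fun x => cos_series n x * g x) =
  series (enum_term (fun m => a m * Rintegral P setT (fun x => tcos m x * g x))) n.
Proof.
move=> mg gM.
have itc m : P.-integrable setT (fun x => (tcos m x * g x)%:E).
  apply: (integrable_bounded_mul P _ _ M) => //.
  by apply: (bounded_integrable P _ 1) => [|x]; [exact: measurable_tcos|exact: cos_max].
elim: n => [|n IH].
  rewrite /series/= big_geq//.
  under eq_Rintegral do rewrite /cos_series /series/= big_geq// mul0r.
  by rewrite Rintegral_cst// mul0r.
rewrite seriesSr -IH.
under eq_Rintegral do rewrite /cos_series seriesSr mulrDl -/(cos_series n _).
rewrite RintegralD//; last 2 first.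
- apply: (integrable_bounded_mul P _ _ M) => //.
  by apply: (bounded_integrable P _ A) => [|x]; [exact: measurable_cos_series|exact: cos_series_bound].
- rewrite /enum_term; case: pickle_inv => [m|]/=.
    under eq_fun do rewrite -mulrA.
    exact: (integrableZl measurableT _ (itc m)).
  under eq_fun do rewrite mul0r.
  exact: integrable0.
congr (_ + _); rewrite /enum_term; case: pickle_inv => [m|]/=.
  under eq_Rintegral do rewrite -mulrA.
  by rewrite RintegralZl//; exact: itc.
under eq_Rintegral do rewrite mul0r.
by rewrite Rintegral_cst// mul0r.
Qed.

(** Termwise integration by bounded convergence: the partial sums times [g] are bounded by
    [A * M]. *)
Lemma cvg_Rintegral_cos_sum (g : torus R d -> R) (M : R) :
  measurable_fun setT g -> (forall x, `|g x| <= M) ->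
  series (enum_term (fun m => a m * Rintegral P setT (fun x => tcos m x * g x))) @ \oo
  --> Rintegral P setT (fun x => cos_sum x * g x).
Proof.
move=> mg gM.
rewrite (_ : series _ = fun n => Rintegral P setT (fun x => cos_series n x * g x));
  last by apply/funext => n; rewrite (Rintegral_cos_series g M).
apply: (bounded_cvg_Rintegral P _ _ (A * M)).
- by move=> n; apply: measurable_funM => //; exact: measurable_cos_series.
- by apply: measurable_funM => //; exact: measurable_cos_sum.
- by move=> n x; rewrite normrM ler_pM// cos_series_bound.
- by move=> x; apply: cvgM; [exact: cos_series_cvg|exact: cvg_cst].
Qed.

(** A cosine times a sine is a combination of sines, so every term of the integrated series is 0. *)
Lemma Rintegral_cos_sum_tsin m : Rintegral P setT (fun x => cos_sum x * tsin m x) = 0.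
Proof.
have h := cvg_Rintegral_cos_sum (tsin m) 1 (measurable_tsin m) (fun x => sin_max _).
rewrite -(cvg_lim _ h)//; apply: cvg_lim => //; apply: cvg_near_cst; apply: nearW => n.
rewrite /series/= big1// => k _; rewrite /enum_term; case: pickle_inv => //= m'.
rewrite (_ : Rintegral _ _ _ = 0) ?mulr0//.
under eq_Rintegral do rewrite mulrC tsin_tcosM mulrDr.
have it k := bounded_integrable P (tsin k) 1 (measurable_tsin k) (fun x => sin_max _).
have itZ k := integrableZl measurableT (1 / 2) (it k).
rewrite RintegralD; [|by []|exact: itZ|exact: itZ].
rewrite !RintegralZl; [|by []|exact: it|by []|exact: it].
by rewrite !(Rintegral_trig _ _).2 mulr0 addr0.
Qed.

(** The integral of [tcos m' * tcos m] gets 1/2 from each of [m' = m] and [m' = -m] that holds; at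
    [m = 0] the two halves add up to 1. *)
Lemma Rintegral_cos_sum_tcos m : Rintegral P setT (fun x => cos_sum x * tcos m x) =
  1 / 2 * (a m + a (subz zeroz m)).
Proof.
have h := cvg_Rintegral_cos_sum (tcos m) 1 (measurable_tcos m) (fun x => cos_max _).
rewrite -(cvg_lim _ h)// {h}; apply: cvg_lim => //.
have subE m' : (subz m' m == zeroz) = (m' == m).
  apply/eqP/eqP => [h|->]; apply: eq_from_tnth => i; last first.
    by rewrite !tnth_mktuple subrr.
  by have := congr1 (fun t => tnth t i) h; rewrite !tnth_mktuple => /subr0_eq.
have addE m' : (addz m' m == zeroz) = (m' == subz zeroz m).
  apply/eqP/eqP => [h|->]; apply: eq_from_tnth => i; last first.
    by rewrite !tnth_mktuple sub0r addNr.
  have := congr1 (fun t => tnth t i) h; rewrite !tnth_mktuple sub0r.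
  by move=> /eqP; rewrite addr_eq0 => /eqP.
have E m' : Rintegral P setT (fun x => tcos m' x * tcos m x) =
    1 / 2 * ((m' == m)%:R + (m' == subz zeroz m)%:R).
  under eq_Rintegral do rewrite tcosM mulrDr.
  have it k := bounded_integrable P (tcos k) 1 (measurable_tcos k) (fun x => cos_max _).
  have itZ k := integrableZl measurableT (1 / 2) (it k).
  rewrite RintegralD; [|by []|exact: itZ|exact: itZ].
  rewrite !RintegralZl; [|by []|exact: it|by []|exact: it].
  rewrite !(Rintegral_trig _ _).1 subE addE -mulrDr.
  by rewrite addrC.
have -> : series (enum_term (fun m' => a m' * Rintegral P setT (fun x => tcos m' x * tcos m x))) =
   (fun n => 1 / 2 * (series (enum_term (fun t => a t * (t == m)%:R)) n +
        series (enum_term (fun t => a t * (t == subz zeroz m)%:R)) n)).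
  apply/funext => n; rewrite /series/= -big_split mulr_sumr/=; apply: eq_bigr => k _.
  rewrite -enum_termD /enum_term; case: pickle_inv => [t|]/=; last by rewrite mulr0.
  by rewrite E; ring.
by apply: cvgM; [exact: cvg_cst|apply: cvgD; exact: cvg_series_enum_delta].
Qed.

End fourier_series.

(** * The uncertainty inequality *)

Section fourier_bounds.
Context {R : realType} {d : nat} (f : torus R d -> R).
Let P := torus_prob R d.
Hypothesis if_ : P.-integrable setT (fun x => (f x)%:E).

Lemma norm_fourier_re_le m : `|fourier_re f m| <= Rintegral P setT (fun x => `|f x|).
Proof.
have ifc : P.-integrable setT (fun x => (f x * tcos m x)%:E).
  apply: (integrable_bounded_mul P _ _ 1) => // [|x]; last exact: cos_max.
  exact: measurable_tcos.
rewrite (le_trans (le_normr_Rintegral measurableT ifc))// le_Rintegral//.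
- exact: (integrable_norm ifc).
- exact: (integrable_norm if_).
- by move=> x _; rewrite normrM -[leRHS]mulr1 ler_wpM2l// cos_max.
Qed.

Lemma ae_le_sum_fourier :
  (forall m, fourier_im f m = 0) ->
  summable setT (fun m => (fourier_re f m)%:E) ->
  {ae P, forall x, `|f x| <= fine (\esum_(m in setT) `|(fourier_re f m)%:E|)%E}.
Proof.
move=> fi sf; pose S := cos_sum (fourier_re f).
have iS : P.-integrable setT (EFin \o S).
  apply: (bounded_integrable P S _ (measurable_cos_sum _ sf)).
  exact: (cos_sum_bound _ sf).
have ift (g : torus R d -> R) : (exists M, forall x, `|g x| <= M) -> measurable_fun setT g ->
    P.-integrable setT (fun x => (f x * g x)%:E) /\
    P.-integrable setT (fun x => (S x * g x)%:E).
  by move=> [M gM] mg; split; exact: (integrable_bounded_mul P _ _ M).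
have hc m : Rintegral P setT (fun x => (f x - S x) * tcos m x) = 0.
  have [|i1 i2] := ift (tcos m) _ (measurable_tcos m).
    by exists 1 => x; exact: cos_max.
  under eq_Rintegral do rewrite mulrBl.
  rewrite RintegralB// (Rintegral_cos_sum_tcos _ sf).
  (* Evenness of the cosine makes the average over [m] and [-m] equal to [fourier_re f m]. *)
  have -> : fourier_re f (subz zeroz m) = fourier_re f m.
    apply: eq_Rintegral => x _; rewrite -/(tcos (subz zeroz m) x).
    by rewrite /tcos dotZB dotZ_zero sub0r mulrN cosN.
  rewrite [X in X - _](_ : _ = fourier_re f m)//.
  by field.
have hs m : Rintegral P setT (fun x => (f x - S x) * tsin m x) = 0.
  have [|i1 i2] := ift (tsin m) _ (measurable_tsin m).
    by exists 1 => x; exact: sin_max.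
  under eq_Rintegral do rewrite mulrBl.
  rewrite RintegralB// (Rintegral_cos_sum_tsin _ sf) subr0.
  by apply/eqP; rewrite -oppr_eq0; apply/eqP; exact: fi.
have : {ae P, forall x, f x - S x = 0}.
  apply: (torus_fourier_eq0 _ _ _ _ hc hs).
  exact: (integrableB measurableT if_ iS).
by apply: filterS => x /subr0_eq ->; exact: (cos_sum_bound _ sf).
Qed.

End fourier_bounds.

(** * Norm bounds through negative parts, for sums and for integrals *)

Lemma esum_const (R : realType) (T : choiceType) (D : set T) (r : R) : 0 <= r ->
  (\esum_(t in D) r%:E <= r%:E * \esum_(t in D) 1)%E.
Proof.
move=> r0; apply: ge_ereal_sup => _ [X [finX XD] <-].
have -> : (\sum_(t \in X) r%:E = r%:E * \sum_(t \in X) (1 : \bar R))%E.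
  rewrite ge0_mule_fsumr//.
  by apply: eq_fsbigr => t _; rewrite mule1.
by apply: lee_wpmul2l; rewrite ?lee_fin//; apply: ereal_sup_ubound; exists X.
Qed.

(** The positive parts [p] sum to at most the sum of the negative parts [n], so the sum of
    [|b| = p + n] is at most twice that of [n], whose nonzero terms are at most [r]. *)
Lemma esum_norm_le_neg (R : realType) d (b : d.-tuple int -> R) (r : R) :
  summable setT (fun m => (b m)%:E) -> (zsum b <= 0)%E -> (forall m, `|b m| <= r) ->
  (\esum_(m in setT) `|(b m)%:E| <=
    2%:E * (r%:E * \esum_(m in [set m | (b m < 0)%R]) 1))%E.
Proof.
move=> sb zb br.
have r0 : 0 <= r by apply: le_trans (br [tuple 0 | i < d]).
pose p m := (Num.max (b m) 0)%:E; pose n m := (Num.max (- b m) 0)%:E.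
have p0 m : (0 <= p m)%E by rewrite lee_fin le_max lexx orbT.
have n0 m : (0 <= n m)%E by rewrite lee_fin le_max lexx orbT.
have E : (\esum_(m in setT) `|(b m)%:E| = \esum_(m in setT) p m + \esum_(m in setT) n m)%E.
  rewrite -esumD//; apply: eq_esum => m _; rewrite /p /n -EFinD /=; congr EFin.
  have [b0|b0] := ger0P (b m); first by rewrite max_r ?addr0// oppr_le0.
  by rewrite add0r max_l// oppr_ge0 ltW.
(* Finiteness of both sums lets the condition on their extended difference be read as an inequality
   between them. *)
have fin : ((\esum_(m in setT) p m)%E \is a fin_num) /\ ((\esum_(m in setT) n m)%E \is a fin_num).
  apply/andP; rewrite -fin_numD -E; by move: sb; rewrite summableE.
have pn : (\esum_(m in setT) p m <= \esum_(m in setT) n m)%E.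
  by rewrite -sube_le0 ?fin.1 ?fin.2.
have nr : (\esum_(m in setT) n m <= r%:E * \esum_(m in [set m | (b m < 0)%R]) 1)%E.
  apply: le_trans (esum_const _ _ _ _ r0).
  rewrite [leRHS]esum_mkcond; apply: le_esum => m _; rewrite /n.
  case: ifPn => [/set_mem/= b0|].
    by rewrite lee_fin ge_max r0 (le_trans _ (br m))// -normrN ler_norm.
  rewrite notin_setE/= => /negP; rewrite -leNgt => b0.
  by rewrite lee_fin ge_max lexx oppr_le0 b0.
rewrite E; apply: le_trans (leeD pn (lexx _)) _.
have -> : (2%:E = 1%:E + 1%:E :> \bar R)%E by rewrite -EFinD.
by rewrite ge0_muleDl// ?mul1e ?lee_fin//; exact: leeD.
Qed.

Lemma measurable_lt0 d (T : measurableType d) (R : realType) (f : T -> R) :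
  measurable_fun setT f -> measurable [set x | f x < 0].
Proof.
move=> mf; rewrite -[X in measurable X]setTI.
rewrite (_ : _ `&` _ = [set: T] `&` f @^-1` `]-oo, 0[%classic).
  by apply: mf => //; exact: measurable_itv.
by apply/seteqP; split => x /=; rewrite in_itv/=.
Qed.
Arguments measurable_lt0 {d T R f}.

(** [|f|] is [f] plus twice its negative part [g]; [f] has nonpositive integral, and almost
    everywhere [g] is at most [A] times the indicator of [f < 0]. *)
Lemma Rintegral_norm_le_neg d (T : measurableType d) (R : realType)
    (P : probability T R) (f : T -> R) (A : R) :
  P.-integrable setT (fun x => (f x)%:E) -> (\int[P]_x (f x)%:E <= 0)%E ->
  0 <= A -> {ae P, forall x, `|f x| <= A} ->
  Rintegral P setT (fun x => `|f x|) <= 2 * (A * fine (P [set x | f x < 0])).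
Proof.
move=> if_ f0 A0 fA.
have mf : measurable_fun setT f by apply/measurable_EFinP; exact: measurable_int if_.
have mN := measurable_lt0 mf.
pose g x := Num.max (- f x) 0.
have mg : measurable_fun setT g.
  by apply: measurable_maxr => //; exact: measurableT_comp.
have ig : P.-integrable setT (EFin \o g).
  apply: (le_integrable measurableT _ _ (integrable_norm if_)).
    exact/measurable_EFinP.
  move=> x _ /=; rewrite lee_fin normr_id /g; case: (ger0P (f x)) => fx.
    by rewrite max_r ?normr0 ?oppr_le0.
  by rewrite max_l ?oppr_ge0 ?(ltW fx)// ger0_norm// oppr_ge0 ltW.
have -> : Rintegral P setT (fun x => `|f x|) =
    Rintegral P setT f + 2 * Rintegral P setT g.
  rewrite -RintegralZl// -RintegralD//; last exact: (integrableZl measurableT _ ig).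
  apply: eq_Rintegral => x _; rewrite /g; case: (ger0P (f x)) => fx.
    by rewrite max_r ?oppr_le0// mulr0 addr0.
  by rewrite max_l ?oppr_ge0 ?(ltW fx)//; ring.
have Rf0 : Rintegral P setT f <= 0 by rewrite /Rintegral fine_le0.
suff : Rintegral P setT g <= A * fine (P [set x | f x < 0]) by lra.
have i1 : P.-integrable setT (fun x => (\1_[set x | f x < 0] x)%:E).
  exact: integrable_indic.
have iN : P.-integrable setT (EFin \o (fun x => A * \1_[set x | f x < 0] x)).
  exact: (integrableZl measurableT A i1).
have -> : A * fine (P [set x | f x < 0]) =
    Rintegral P setT (fun x => A * \1_[set x | f x < 0] x).
  rewrite RintegralZl//.
  by rewrite /Rintegral integral_indic// setIT.
rewrite fine_le ?integrable_fin_num//.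
apply: ae_ge0_le_integral => //.
- by move=> x _; rewrite lee_fin le_max lexx orbT.
- exact/measurable_EFinP.
- by move=> x _; rewrite lee_fin mulr_ge0.
- exact: measurable_int iN.
apply: filterS fA => x fx _; rewrite lee_fin /g indicE.
case: (ger0P (f x)) => f0x; first by rewrite max_r ?oppr_le0// mulr_ge0.
by rewrite mem_set//= mulr1 max_l ?oppr_ge0 ?(ltW f0x)// -normrN in fx *;
 rewrite (le_trans (ler_norm _)).
Qed.

Theorem mainTheorem12 (R : realType) (d : nat) (s : R) (f : torus R d -> R) :
  (1 <= d)%N ->
  (s = 1 \/ s = -1) ->
  (torus_prob R d).-integrable setT (fun x => (f x)%:E) ->
  ~ {ae torus_prob R d, forall x, f x = 0} ->
  (forall m : d.-tuple int, fourier_im f m = 0) ->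
  summable setT (fun m : d.-tuple int => (fourier_re f m)%:E) ->
  (\int[torus_prob R d]_x (f x)%:E <= 0)%E ->
  (zsum (fun m : d.-tuple int => (s * fourier_re f m)%R) <= 0)%E ->
  ((torus_prob R d [set x | (f x < 0)%R]) *
     (\esum_(m in [set m : d.-tuple int | (s * fourier_re f m < 0)%R]) 1)
   >= (1 / 16)%:E)%E.
Proof.
move=> _ s1 if_ fn0 fi sf f0 zf.
have s_norm : `|s| = 1 by case: s1 => ->; rewrite ?normrN normr1.
pose P := torus_prob R d.
set K := (\esum_(m in _) 1)%E.
pose r := Rintegral P setT (fun x => `|f x|).
pose A := fine (\esum_(m in setT) `|(fourier_re f m)%:E|)%E.
pose l := fine (P [set x | f x < 0]).
have r_gt0 : 0 < r.
  rewrite lt_neqAle Rintegral_ge0// andbT eq_sym; apply/negP => /eqP r0.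
  apply: fn0; have : (\int[P]_x `|(f x)%:E| = 0)%E.
    transitivity r%:E; last by rewrite r0.
    rewrite /r /Rintegral fineK//.
    exact: (integrable_fin_num measurableT (integrable_abse if_)).
  move=> /(ae_eq_integral_abs P measurableT (measurable_int _ if_)).
  by apply: filterS => x /= /(_ I) [].
have A0 : 0 <= A by rewrite fine_ge0// esum_ge0.
have l0 : 0 <= l by rewrite fine_ge0.
have rA : r <= 2 * (A * l).
  by apply: Rintegral_norm_le_neg => //; exact: ae_le_sum_fourier.
have Ar : (A%:E <= 2%:E * (r%:E * K))%E.
  (* As [|s| = 1], multiplication by [s] preserves both the total [A] and the bound [r]. *)
  have nE m : `|(s * fourier_re f m)%:E|%E = `|(fourier_re f m)%:E|%E.
    by rewrite /= normrM s_norm mul1r.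
  have -> : A%:E = (\esum_(m in setT) `|(s * fourier_re f m)%:E|)%E.
    rewrite /A fineK; first by apply: eq_esum => m _; rewrite nE.
    by move: sf; rewrite summableE.
  apply: esum_norm_le_neg => //.
    by rewrite /summable; under eq_esum do rewrite nE.
  by move=> m; rewrite normrM s_norm mul1r; exact: norm_fourier_re_le.
have -> : P [set x | f x < 0] = l%:E.
  rewrite fineK// fin_num_measure//; apply: measurable_lt0.
  by apply/measurable_EFinP; exact: measurable_int if_.
(* This excludes a product of 0 and [+oo] when infinitely many coefficients are negative. *)
have l_gt0 : 0 < l.
  rewrite lt_neqAle l0 andbT eq_sym; apply/eqP => l00.
  by move: rA; rewrite l00 !mulr0 leNgt r_gt0.
have K0 : (0 <= K)%E by exact: esum_ge0.
case: K K0 Ar => [k| |]// => [k0 Ar|_ _]; last by rewrite gt0_muley ?lte_fin// leey.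
rewrite -!EFinM !lee_fin in k0 Ar *.
(* In the finite case [r <= 2 A l] and [A <= 2 r k] combine; cancelling [r > 0] gives
   [l k >= 1/4]. *)
have h : r <= r * (4 * (l * k)).
  rewrite (le_trans rA)//.
  have -> : r * (4 * (l * k)) = 2 * (l * (2 * (r * k))) by ring.
  by rewrite ler_pM2l// mulrC ler_wpM2l.
have : 1 <= 4 * (l * k) by rewrite -(ler_pM2l r_gt0) mulr1.
lra.
Qed.
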